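(* Let $G$ be a connected graph with $n$ vertices and minimum degree $\delta$. If $\delta\ge n/2$ and $n\ge 4$, then $pc_2(G)=2$.
   Context: All graphs are finite and simple. In an edge-colored graph (adjacent edges may have the same color), a path is proper if no two adjacent edges of the path have the same color. An edge-colored graph is $k$-proper connected if any two distinct vertices are connected by $k$ internally pairwise vertex-disjoint proper paths. For a $k$-connected graph $G$, the $k$-proper connection number $pc_k(G)$ is the smallest number of colors in an edge-coloring that makes $G$ $k$-proper connected. *)

(* Defs.v *)
From mathcomp Require Import all_boot.

Set Implicit Arguments.
Unset Strict Implicit.
Unset Printing Implicit Defensive.

(* A finite simple graph is a symmetric irreflexive relation e on a finType T;
   the edge joining u and v is the set [set u; v]. *)
Definition simple_graph (T : finType) (e : rel T) : Prop :=
  symmetric e /\ irreflexive e.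

Definition connected_graph (T : finType) (e : rel T) : Prop :=
  0 < #|T| /\ forall x y : T, connect e x y.

Definition degree (T : finType) (e : rel T) (x : T) : nat := #|[set y | e x y]|.

(* The default #|T| exceeds every degree of a simple graph, so it is attained
   only when T is empty. *)
Definition min_degree (T : finType) (e : rel T) : nat :=
  \big[minn/#|T|]_(x : T) degree e x.

Definition induced (T : finType) (e : rel T) (A : {set T}) : rel T :=
  [rel x y | [&& x \in A, y \in A & e x y]].

Definition k_connected (T : finType) (e : rel T) (k : nat) : Prop :=
  k < #|T| /\
  forall S : {set T}, #|S| < k ->
    forall x y, x \notin S -> y \notin S -> connect (induced e (~: S)) x y.

(* A path from x to y is represented by x and the sequence p of the vertices
   that follow x. *)
Definition path_between (T : finType) (e : rel T) (x y : T) (p : seq T) : Prop :=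
  [/\ path e x p, last x p = y & uniq (x :: p)].

Definition path_edges (T : finType) (x : T) (p : seq T) : seq {set T} :=
  pairmap (fun u v => [set u; v]) x p.

Definition interior (T : finType) (x : T) (p : seq T) : seq T :=
  behead (belast x p).

(* Edges of a path are adjacent exactly when they are consecutive. Only the
   values of c on edges of the graph matter. *)
Definition proper_path (T : finType) (c : {set T} -> nat) (x : T) (p : seq T)
    : Prop :=
  sorted (fun f g : {set T} => c f != c g) (path_edges x p).

(* Injectivity forbids counting the one-edge path, whose interior is empty,
   several times. *)
Definition k_proper_connected (T : finType) (e : rel T) (c : {set T} -> nat)
    (k : nat) : Prop :=
  forall x y : T, x != y ->
    exists P : 'I_k -> seq T,
      [/\ injective P,
          forall i, path_between e x y (P i) /\ proper_path c x (P i) &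
          forall i j, i != j ->
            forall z, ~~ ((z \in interior x (P i)) && (z \in interior x (P j)))].

Definition k_proper_colorable (T : finType) (e : rel T) (k m : nat) : Prop :=
  exists c : {set T} -> nat,
    (forall x y, e x y -> c [set x; y] < m) /\ k_proper_connected e c k.

(* pc_k(G) = m; the number pc_k(G) is only defined for k-connected G. *)
Definition is_pc (T : finType) (e : rel T) (k m : nat) : Prop :=
  [/\ k_connected e k,
      k_proper_colorable e k m &
      forall m', k_proper_colorable e k m' -> m <= m'].

(* Main.v *)
(* When n is even, a Hamiltonian cycle (Dirac) coloured alternately gives two
   proper paths between any two vertices. When n is odd, fix a vertex v; by
   Dirac again the rest carries an even Hamiltonian cycle, coloured
   alternately. The colour of an edge v w decides in which direction a proper
   path from v may continue along the cycle from w; alternating the two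
   directions over the neighbours of v, read from a non-neighbour on, every
   non-neighbour of v lies between a neighbour directed down and a neighbour
   directed up towards it. *)
Require Import Defs.
From mathcomp Require Import all_boot.
From mathcomp Require Import zify.

Set Implicit Arguments.
Unset Strict Implicit.
Unset Printing Implicit Defensive.

(** * Dirac's theorem relative to a vertex set *)

Section HamiltonCycle.

Variables (T : finType) (e : rel T).
Hypotheses (e_sym : symmetric e) (e_irr : irreflexive e).

Let nbrs (A : {set T}) x := [set y in A | e x y].

Lemma leq_card_count (B : {set T}) (a : pred T) (s : seq T) :
  (forall y, y \in B -> a y && (y \in s)) -> #|B| <= count a s.
Proof.
move=> sub; rewrite cardE -size_filter; apply: uniq_leq_size (enum_uniq _) _.
by move=> y; rewrite mem_enum mem_filter => /sub.
Qed.

Lemma longest_path (A : {set T}) : A != set0 ->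
  exists s : seq T, [/\ 0 < size s, uniq s, sorted e s, {subset s <= A} &
    forall t, uniq t -> sorted e t -> {subset t <= A} -> size t <= size s].
Proof.
case/set0Pn=> a aA.
(* Tuples of fixed size make existence decidable, so that a maximal size can be extracted. *)
pose P k := [exists t : k.-tuple T, [&& uniq t, sorted e t & all (mem A) t]].
have exP : exists k, P k.
  by exists 1; apply/existsP; exists [tuple a]; rewrite /= aA.
have ubP k : P k -> k <= #|T|.
  case/existsP=> t /and3P[t_uniq _ _].
  by rewrite -(size_tuple t) -(card_uniqP t_uniq) max_card.
case: (ex_maxnP exP ubP) => k /existsP[t /and3P[t_uniq t_path /allP tA]] max_k.
have maxP s : uniq s -> sorted e s -> {subset s <= A} -> size s <= k.
  move=> s_uniq s_path sA; apply: max_k; apply/existsP.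
  by exists (in_tuple s); rewrite s_uniq s_path; apply/allP.
exists t; rewrite size_tuple; split=> //.
by apply: (maxP [:: a]) => // y; rewrite inE => /eqP->.
Qed.

(** If a path is cut into the pieces [x :: s] and [y :: t], two crossing edges replace the cut edge:
    the cycle runs along the first piece, jumps to the end of the second, and follows it backwards
    to [y] and [x]. *)
Lemma crossing_cycle x s y t :
  path e x s -> path e y t -> e (last x s) (last y t) -> e x y ->
  cycle e ((x :: s) ++ rev (y :: t)).
Proof.
move=> xs yt e_last e_xy.
have rev_yt : path e (last y t) (rev (belast y t)).
  by rewrite rev_path (eq_path (e' := e)) // => u w; rewrite e_sym.
rewrite (lastI y) rev_rcons /= rcons_cat cat_path xs /= e_last rcons_path rev_yt /=.
suff -> : last (last y t) (rev (belast y t)) = y by rewrite e_sym.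
by case: t {yt e_last rev_yt} => //= z t; rewrite rev_cons last_rcons.
Qed.

(** The ends of a longest path in [A] have all their neighbours on it; pigeonhole gives a crossing
    pair, hence a cycle on the same vertices, and a vertex of [A] off this cycle contradicts
    maximality or the degree bound. *)
Lemma dirac (A : {set T}) :
  A != set0 -> (forall x, x \in A -> #|A| <= 2 * #|nbrs A x|) ->
  exists s : seq T, [/\ uniq s, cycle e s & s =i A].
Proof.
move=> A_n0 deg_A; have [s [s_gt0 s_uniq s_path sA s_max]] := longest_path A_n0.
case: s s_gt0 s_uniq s_path sA s_max => // x p _ s_uniq s_path sA s_max.
set s := x :: p in s_uniq s_path sA s_max; set z := last x p.
have zs : z \in s by rewrite mem_last.
(* A neighbour of [x] off the path could be prepended to it; symmetrically, one of [z] could be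
   appended. *)
have nbr_x y : y \in nbrs A x -> e x y && (y \in p).
  rewrite inE => /andP[yA xy]; rewrite xy; apply: contraLR (xy) => y_p.
  have [->|y_x] := eqVneq y x; first by rewrite e_irr.
  apply: contraTN (ltnSn (size s)) => _; rewrite -leqNgt.
  apply: (s_max (y :: s)) => //=; first by rewrite inE negb_or y_x y_p.
    by rewrite e_sym xy.
  by move=> w; rewrite inE => /predU1P[->//|/sA].
have nbr_z y : y \in nbrs A z -> e z y && (y \in belast x p).
  rewrite inE => /andP[yA zy]; rewrite zy; apply: contraLR (zy) => y_p.
  have [->|y_z] := eqVneq y z; first by rewrite e_irr.
  apply: contraTN (ltnSn (size s)) => _; rewrite -leqNgt -(size_rcons s y).
  apply: (s_max (rcons s y)).
  - by rewrite rcons_uniq s_uniq andbT /s lastI mem_rcons inE negb_or y_z y_p.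
  - by rewrite /= rcons_path -/z zy andbT.
  by move=> w; rewrite mem_rcons inE => /predU1P[->//|/sA].
have s_sz : size s <= #|A|.
  by rewrite -(card_uniqP s_uniq); apply/subset_leq_card/subsetP.
(* Index shift: [nth x s i] is the predecessor on the path of [nth x p i], so [a i] and [b i]
   together give a crossing pair. *)
pose a i := e x (nth x p i); pose b i := e z (nth x s i).
have count_a : count a (iota 0 (size p)) = count (e x) p.
  by rewrite -[in RHS](mkseq_nth x p) count_map.
have count_b : count b (iota 0 (size p)) = count (e z) (belast x p).
  rewrite -[in RHS](mkseq_nth x (belast x p)) count_map size_belast.
  apply: eq_in_count => i; rewrite mem_iota /= add0n /b /s lastI => i_p.
  by rewrite nth_rcons size_belast i_p.
have deg_x : #|nbrs A x| <= count (e x) p by apply: leq_card_count.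
have deg_z : #|nbrs A z| <= count (e z) (belast x p) by apply: leq_card_count.
have xA : x \in A by rewrite sA ?mem_head.
have zA : z \in A by rewrite sA.
(* Pigeonhole: the two counts sum to at least [#|A|], which exceeds the number [size p] of
   indices. *)
have : has (predI a b) (iota 0 (size p)).
  rewrite has_count; have := count_predUI a b (iota 0 (size p)).
  have := count_size (predU a b) (iota 0 (size p)); rewrite size_iota.
  have := deg_A x xA; have := deg_A z zA; move: s_sz deg_x deg_z.
  by rewrite count_a count_b /s /=; clear; lia.
case/hasP=> i; rewrite mem_iota add0n => /= i_p /andP[a_i b_i].
pose c := (x :: take i p) ++ rev (drop i p).
have c_perm : perm_eq c s.
  by rewrite /c /s /= perm_cons -[X in perm_eq _ X](cat_take_drop i p) perm_cat2l perm_rev.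
have c_uniq : uniq c by rewrite (perm_uniq c_perm).
have c_cycle : cycle e c.
  rewrite /c; move: s_path a_i b_i; rewrite /s /= /a /b.
  rewrite -{1}(cat_take_drop i p) cat_path (drop_nth x i_p) => /andP[xt].
  case/andP=> _ pt xy zy; apply: crossing_cycle => //.
  have -> : last (nth x p i) (drop i.+1 p) = z.
    by rewrite /z -[in RHS](cat_take_drop i p) last_cat (drop_nth x i_p).
  suff -> : last x (take i p) = nth x s i by rewrite e_sym.
  rewrite (last_nth x) size_takel ?(ltnW i_p) // -[x :: _]/(take i.+1 s).
  by rewrite nth_take.
have cA w : w \in c -> w \in A by rewrite (perm_mem c_perm) => /sA.
exists c; split=> // u; apply/idP/idP=> [/cA //|uA]; apply: contraT => u_c.
(* If [u] has a neighbour [w] on the cycle, opening the cycle at [w] and prepending [u] gives a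
   longer path. *)
have [/hasP[w wc uw]|/hasPn no_nbr] := boolP (has (e u) c).
  case: (rot_to wc) => i' c' c_rot.
  have : path e w c'.
    have: cycle e (w :: c') by rewrite -c_rot rot_cycle.
    by rewrite /= rcons_path => /andP[].
  have mem_c' y : (y \in w :: c') = (y \in c) by rewrite -c_rot mem_rot.
  move=> wc'; have := s_max [:: u, w & c'].
  rewrite -[size (_ :: _)]/(size (w :: c')).+1 -c_rot size_rot.
  rewrite (perm_size c_perm) ltnn; apply; rewrite ?c_rot.
  - by rewrite cons_uniq mem_c' u_c -c_rot rot_uniq.
  - by rewrite /= uw.
  by move=> y; rewrite inE mem_c' => /predU1P[->//|/cA].
(* Otherwise the neighbours of [u] avoid [u] and the cycle. The cycle already contains [x] and its
   neighbours, more than half of [A], so too few vertices remain. *)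
have : #|nbrs A u| <= #|A :\: [set y in u :: c]|.
  apply/subset_leq_card/subsetP => y; rewrite !inE => /andP[yA uy].
  rewrite yA andbT negb_or; apply/andP; split.
    by apply: contraTneq uy => ->; rewrite e_irr.
  by apply: contraTN uy => /no_nbr.
have uc_sub : [set y in u :: c] \subset A.
  by apply/subsetP=> y; rewrite !inE => /predU1P[->//|/cA].
rewrite cardsD (setIidPr uc_sub).
have -> : #|[set y in u :: c]| = (size s).+1.
  rewrite -(perm_size c_perm) cardsE; apply/(card_uniqP (s := u :: c)).
  by rewrite cons_uniq u_c.
have := count_size (e x) p; have := deg_A u uA; have := deg_A x xA.
by move: deg_x s_sz; rewrite /s /=; clear; lia.
Qed.

End HamiltonCycle.

(** * Pairs of disjoint proper paths, as indexed sequences *)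

Section LinkedPairs.

Variables (T : finType) (e : rel T) (c : {set T} -> nat).

(** A path is a function on [nat] read on [0..k], so that reversals and arcs of a cycle become
    substitutions in the index. *)
Definition proper_link (y : nat -> T) k : Prop :=
  [/\ forall i j, i <= k -> j <= k -> y i = y j -> i = j,
      forall i, i < k -> e (y i) (y i.+1) &
      forall i, i.+1 < k -> c [set y i; y i.+1] != c [set y i.+1; y i.+2]].

(* The bound on maxn k1 k2 excludes that both paths are the edge u w. *)
Definition linked2 u w : Prop :=
  exists y1 k1 y2 k2,
    [/\ proper_link y1 k1 /\ proper_link y2 k2,
        [/\ y1 0 = u, y1 k1 = w, y2 0 = u & y2 k2 = w],
        forall i j, 0 < i < k1 -> 0 < j < k2 -> y1 i <> y2 j &
        1 < maxn k1 k2].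

Lemma proper_link_rev y k :
  symmetric e -> proper_link y k -> proper_link (fun i => y (k - i)) k.
Proof.
move=> e_sym [y_inj y_e y_c]; split.
- move=> i j ik jk /y_inj; lia.
- move=> i ik; rewrite e_sym.
  have -> : k - i = (k - i.+1).+1 by lia.
  apply: y_e; lia.
move=> i ik; rewrite eq_sym (setUC [set y (k - i)]) (setUC _ [set y (k - i.+2)]).
have -> : k - i = (k - i.+2).+2 by lia.
have -> : k - i.+1 = (k - i.+2).+1 by lia.
apply: y_c; lia.
Qed.

Lemma linked2_sym u w : symmetric e -> linked2 u w -> linked2 w u.
Proof.
move=> e_sym [y1 [k1 [y2 [k2 [[l1 l2] [y1u y1w y2u y2w] dis k_gt1]]]]].
exists (fun i => y1 (k1 - i)), k1, (fun i => y2 (k2 - i)), k2; split=> //.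
- by split; apply: proper_link_rev.
- by rewrite !subn0 !subnn.
by move=> i j ik jk; apply: dis; lia.
Qed.

Let walk (y : nat -> T) k := mkseq (fun i => y i.+1) k.

Lemma walk_rec y k : y 0 :: walk y k = mkseq y k.+1.
Proof. by rewrite /walk /mkseq /= (iotaDl 1 0) -map_comp. Qed.

Lemma last_walk y k : last (y 0) (walk y k) = y k.
Proof.
case: k => // k; rewrite (last_nth (y 0)) size_mkseq walk_rec nth_mkseq //.
Qed.

Lemma path_walk y k : proper_link y k -> path_between e (y 0) (y k) (walk y k).
Proof.
case=> y_inj y_e _; split; last 1 first.
- rewrite walk_rec map_inj_in_uniq ?iota_uniq // => i j.
  by rewrite !mem_iota => ik jk; apply: y_inj; lia.
- apply/(pathP (y 0)) => i; rewrite size_mkseq => ik.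
  rewrite walk_rec nth_mkseq ?(ltn_trans ik) // nth_mkseq //; exact: y_e.
exact: last_walk.
Qed.

Lemma path_edges_walk y k :
  path_edges (y 0) (walk y k) = mkseq (fun i => [set y i; y i.+1]) k.
Proof.
apply: (@eq_from_nth _ set0); rewrite ?size_pairmap !size_mkseq // => i ik.
rewrite (nth_pairmap (y 0)) ?size_mkseq // walk_rec !nth_mkseq //.
exact: ltnW.
Qed.

Lemma proper_walk y k : proper_link y k -> proper_path c (y 0) (walk y k).
Proof.
case=> _ _ y_c; rewrite /proper_path path_edges_walk.
apply/(sortedP set0) => i; rewrite size_mkseq => ik.
by rewrite !nth_mkseq ?y_c //; apply: ltnW.
Qed.

Lemma interior_walk y k :
  interior (y 0) (walk y k) = [seq y i | i <- iota 1 k.-1].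
Proof.
rewrite /interior.
have -> : belast (y 0) (walk y k) = mkseq y k.
  case: k => // k; apply: (@rcons_injl _ (y k.+1)).
  by rewrite -{1}(last_walk y k.+1) -lastI walk_rec mkseqS.
by case: k.
Qed.

Lemma mem_interior_walk y k z :
  z \in interior (y 0) (walk y k) -> exists2 i, 0 < i < k & z = y i.
Proof.
rewrite interior_walk => /mapP[i]; rewrite mem_iota => ik ->.
by exists i => //; lia.
Qed.

(** Equal walks would have equal length greater than 1, so their second vertices would be a shared
    interior vertex. *)
Lemma walk_neq y1 y2 k1 k2 : y1 0 = y2 0 -> 0 < k1 -> 0 < k2 ->
  1 < maxn k1 k2 ->
  (forall i j, 0 < i < k1 -> 0 < j < k2 -> y1 i <> y2 j) ->
  walk y1 k1 <> walk y2 k2.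
Proof.
move=> y0 k1_gt0 k2_gt0 k_gt1 dis eq_w.
have eq_k : k1 = k2 by have := congr1 size eq_w; rewrite !size_mkseq.
have := congr1 (nth (y1 0) ^~ 0) eq_w; rewrite !nth_mkseq //.
by apply: dis; lia.
Qed.

Lemma ord2_inj (i j : 'I_2) : (i == ord0) = (j == ord0) -> i = j.
Proof.
by move=> eq_ij; apply/val_inj; case: i j eq_ij => [[|[|i]] hi] [[|[|j]] hj].
Qed.

Lemma linked2_k_proper_connected :
  (forall u w, u != w -> linked2 u w) -> k_proper_connected e c 2.
Proof.
move=> linked u w u_w.
have [y1 [k1 [y2 [k2 [[l1 l2] [y1u y1w y2u y2w] dis k_gt1]]]]] := linked _ _ u_w.
have k1_gt0 : 0 < k1.
  by rewrite lt0n; apply: contraNneq u_w => k0; rewrite -y1u -y1w k0.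
have k2_gt0 : 0 < k2.
  by rewrite lt0n; apply: contraNneq u_w => k0; rewrite -y2u -y2w k0.
have neq_w : walk y1 k1 <> walk y2 k2 by apply: walk_neq; rewrite ?y1u.
pose P (i : 'I_2) := if i == ord0 then walk y1 k1 else walk y2 k2.
have disP z : ~~ ((z \in interior u (walk y1 k1)) && (z \in interior u (walk y2 k2))).
  apply/andP; rewrite -{1}y1u -y2u => -[/mem_interior_walk[i ik ->]].
  by case/mem_interior_walk=> j jk /dis; apply.
exists P; rewrite /P; split.
- move=> i j; case i0: (i == ord0); case j0: (j == ord0) => // eq_ij;
    by [apply: ord2_inj; rewrite i0 j0 | case: neq_w].
- move=> i; case: eqP => _.
  + by have := path_walk l1; have := proper_walk l1; rewrite y1u y1w.
  by have := path_walk l2; have := proper_walk l2; rewrite y2u y2w.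
move=> i j i_j z; case i0: (i == ord0); case j0: (j == ord0) => //.
- by case/eqP: i_j; apply: ord2_inj; rewrite i0 j0.
- by rewrite andbC.
by case/eqP: i_j; apply: ord2_inj; rewrite i0 j0.
Qed.

(** * Linked pairs along an alternately coloured cycle *)

Section AlternatingCycle.

Variables (N : nat) (x : nat -> T).
Hypotheses (N_gt2 : 2 < N) (e_sym : symmetric e).
(** The cycle is unrolled into an [N]-periodic sequence, so arcs passing the starting vertex need no
    separate case. *)
Hypothesis x_window : forall a i j, i < N -> j < N -> x (a + i) = x (a + j) -> i = j.
Hypothesis x_period : forall i, x (i + N) = x i.
Hypothesis x_edge : forall i, e (x i) (x i.+1).
Hypothesis x_color : forall i, c [set x i; x i.+1] = odd i.

Lemma up_link a k : k < N -> proper_link (fun i => x (a + i)) k.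
Proof.
move=> kN; split=> [i j ik jk|i ik|i ik].
- by apply: x_window; lia.
- by rewrite addnS.
by rewrite !addnS !x_color /=; case: odd.
Qed.

Lemma down_link a k : k < N -> k <= a -> proper_link (fun i => x (a - i)) k.
Proof.
move=> kN ka; have /(proper_link_rev e_sym) := up_link (a - k) kN.
case=> y_inj y_e y_c.
have E i : i <= k -> a - k + (k - i) = a - i by lia.
split=> [i j ik jk xij|i ik|i ik].
- by apply: y_inj; rewrite ?E.
- by rewrite -(E i (ltnW ik)) -(E i.+1 ik) y_e.
by rewrite -(E i) -?(E i.+1) -?(E i.+2) ?y_c //; lia.
Qed.

Lemma cycle_linked2 a k : 0 < k < N -> linked2 (x a) (x (a + k)).
Proof.
(* The two arcs of the cycle. The descending one starts at [a + N], which names the same vertex as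
   [a] and keeps the subtraction from truncating. *)
move=> kN; exists (fun i => x (a + i)), k, (fun i => x (a + N - i)), (N - k).
split.
- by split; [apply: up_link | apply: down_link]; lia.
- by rewrite addn0 subn0 x_period; split=> //; congr x; lia.
- move=> i j ik jk; have -> : a + N - j = a + (N - j) by lia.
  by move/x_window; lia.
lia.
Qed.

Variable v : T.
Hypothesis x_v : forall i, x i <> v.

Let from_v (y : nat -> T) i := if i is j.+1 then y j else v.

Lemma from_v_link y k :
  proper_link y k -> (forall i, y i <> v) -> e v (y 0) ->
  (0 < k -> c [set v; y 0] != c [set y 0; y 1]) ->
  proper_link (from_v y) k.+1.
Proof.
move=> [y_inj y_e y_c] y_v vy vy_c; split.
- move=> [|i] [|j] //= ik jk; first by move/esym/y_v.
    by move/y_v.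
  by move/y_inj->.
- by case=> //= i /y_e.
by case=> //= i /y_c.
Qed.

(* The two paths leave v through x (b + q) and x (b + p), and then run along
   the cycle down from x (b + q) and up from x (b + p), to x b. *)
Lemma spoke_linked2 b q p :
  q < p <= N -> 0 < q \/ p < N ->
  e v (x (b + q)) -> e v (x (b + p)) ->
  (0 < q -> c [set v; x (b + q)] = odd (b + q)) ->
  (p < N -> c [set v; x (b + p)] = ~~ odd (b + p)) ->
  linked2 v (x b).
Proof.
move=> qpN qp e_q e_p c_q c_p.
exists (from_v (fun i => x (b + q - i))), q.+1.
exists (from_v (fun i => x (b + p + i))), (N - p).+1; split.
- split; apply: from_v_link; rewrite ?subn0 ?addn0 //.
  + by apply: down_link; lia.
  + move=> q_gt0; rewrite c_q // setUC; case: (b + q) (leq_addl b q) => [|r] q_r.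
      by case: q q_gt0 q_r {qpN qp e_q c_q}.
    by rewrite subn1 /= x_color; case: odd.
  + by apply: up_link; lia.
  by move=> p_N; rewrite c_p ?addn1 ?x_color; [case: odd | lia].
- split=> //=; first by congr x; lia.
  by rewrite -[RHS]x_period; congr x; lia.
(* The interiors use offsets from [b] in [1..q] and in [p..N-1], which are disjoint within one
   window. *)
- case=> [|i] [|j] //= ik jk.
  have -> : b + q - i = b + (q - i) by lia.
  by rewrite -addnA => /x_window; lia.
(* For [q = 0] or [p = N] a path is just the edge to [x b]; the assumption [0 < q \/ p < N] prevents
   this for both at once. *)
lia.
Qed.

End AlternatingCycle.

End LinkedPairs.

(** * Ranks of the hits of a predicate *)

Section Rank.

Variable p : pred nat.

Let r i := count p (iota 0 i).

Lemma rankS i : r i.+1 = r i + p i.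
Proof. by rewrite /r -addn1 iotaD count_cat /= addn0. Qed.

(** The rank increases by one exactly at hits, so each smaller value is left at some hit. This
    selects the neighbour of given rank. *)
Lemma rank_hit N j : j < r N -> exists i, [/\ i < N, p i & r i = j].
Proof.
elim: N => [|N IHN] //; rewrite rankS => j_lt.
have [/IHN[i [iN pi ri]]|j_ge] := ltnP j (r N).
  by exists i; split=> //; apply: ltnW.
by exists N; case: (p N) j_lt => /=; [split=> // | ]; lia.
Qed.

Lemma rank_lt i j : r i < r j -> i < j.
Proof.
apply: contraLR; rewrite -!leqNgt => /subnK<-; elim: (i - j) => // d.
by rewrite addSn rankS => /leq_trans; apply; apply: leq_addr.
Qed.

End Rank.

(** * Periodic indexing and alternate colouring of a cycle *)

Section CyclicIndexing.

Variables (T : finType) (s : seq T) (x0 : T).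
Hypotheses (s_uniq : uniq s) (s_gt2 : 2 < size s).

Let N := size s.

Definition cyc_nth i := nth x0 s (i %% size s).

Let x := cyc_nth.

Lemma cyc_nth_eq i j : (x i == x j) = (i == j %[mod N]).
Proof. by rewrite /x /cyc_nth nth_uniq // ltn_mod; apply: ltn_trans s_gt2. Qed.

Lemma cyc_nth_mod i j : i = j %[mod N] -> x i = x j.
Proof. by move=> ij; apply/eqP; rewrite cyc_nth_eq ij. Qed.

Lemma cyc_nth_window a i j : i < N -> j < N -> x (a + i) = x (a + j) -> i = j.
Proof.
by move=> iN jN /eqP; rewrite cyc_nth_eq eqn_modDl !modn_small // => /eqP.
Qed.

Lemma cyc_nth_period i : x (i + N) = x i.
Proof. by apply: cyc_nth_mod; rewrite modnDr. Qed.

Lemma cyc_nth_modS i : x (i %% N).+1 = x i.+1.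
Proof. by apply: cyc_nth_mod; rewrite -addn1 modnDml addn1. Qed.

Lemma cyc_nth_edge (e : rel T) i : cycle e s -> e (x i) (x i.+1).
Proof.
move=> s_cycle; have N_gt0 : 0 < N by apply: ltn_trans s_gt2.
rewrite -cyc_nth_modS -(cyc_nth_mod (modn_mod i N)).
move: (i %% N) (ltn_pmod i N_gt0) => j jN.
rewrite /x /cyc_nth (modn_small jN).
move: jN s_cycle; rewrite /N; case: s => // z p jN /= /(pathP x0).
move=> /(_ j); rewrite size_rcons -rcons_cons !nth_rcons /= => /(_ jN).
rewrite jN; have [j_p||] := ltngtP j (size p); last by move->; rewrite modnn.
  by rewrite modn_small.
by move: jN => /= jN; rewrite ltnNge -ltnS jN.
Qed.

Lemma cyc_nth_mem i : x i \in s.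
Proof. by rewrite mem_nth // ltn_mod; apply: ltn_trans s_gt2. Qed.

Lemma cyc_nthP w : w \in s -> exists2 i, i < N & w = x i.
Proof.
move=> ws; exists (index w s); first by rewrite index_mem.
by rewrite /x /cyc_nth modn_small ?index_mem // nth_index.
Qed.

Lemma cyc_nth_offset a w : a < N -> w \in s -> w != x a ->
  exists2 k, 0 < k < N & w = x (a + k).
Proof.
move=> aN /cyc_nthP[i iN ->] xi_xa.
have i_a : i != a by apply: contraNneq xi_xa => ->.
have [ai|ia] := ltnP a i.
  by exists (i - a); [lia | congr x; lia].
exists (i + N - a); first lia.
by rewrite subnKC ?cyc_nth_period //; lia.
Qed.

Definition alt_color (f : {set T}) : bool :=
  [exists i : 'I_N, odd i && (f == [set x i; x i.+1])].

(** For [N] even, vertices have a well-defined parity. An even edge equal to an odd edge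
    [[set x j; x j.+1]] would thus match crosswise, giving [i] congruent to [i + 2] modulo [N],
    impossible as [N > 2]. *)
Lemma alt_colorE i : ~~ odd N -> alt_color [set x i; x i.+1] = odd i.
Proof.
move=> N_even; have N_gt0 : 0 < N by apply: ltn_trans s_gt2.
have odd_modN j : odd (j %% N) = odd j by rewrite odd_mod // (negbTE N_even).
case i_odd: (odd i).
  apply/existsP; exists (Ordinal (ltn_pmod i N_gt0)).
  by rewrite /= odd_modN i_odd cyc_nth_modS (cyc_nth_mod (modn_mod i N)) eqxx.
apply/existsP=> -[j /andP[j_odd /eqP eq_ij]].
have neq_ij k l : odd k -> ~~ odd l -> x l != x k.
  move=> k_odd; apply: contraNneq => xlk; rewrite -odd_modN.
  by move/eqP: xlk; rewrite cyc_nth_eq => /eqP->; rewrite odd_modN.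
have : x i \in [set x j; x j.+1] by rewrite -eq_ij !inE eqxx.
rewrite !inE (negbTE (neq_ij _ _ j_odd _)) ?i_odd //= cyc_nth_eq => /eqP ij.
have : x j \in [set x i; x i.+1] by rewrite eq_ij !inE eqxx.
rewrite !inE eq_sym (negbTE (neq_ij _ _ j_odd _)) ?i_odd //= cyc_nth_eq => /eqP ji.
have : x (i + 0) = x (i + 2).
  apply: cyc_nth_mod; rewrite addn0 ij -addn1 -modnDml ji modnDml.
  by rewrite -addn1 -addnA.
by move/cyc_nth_window => /(_ N_gt0 s_gt2).
Qed.

End CyclicIndexing.

(** * Even order: the Hamiltonian cycle suffices *)

Lemma hamiltonian_even (T : finType) (e : rel T) (s : seq T) :
  symmetric e -> uniq s -> cycle e s -> 2 < size s -> ~~ odd (size s) ->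
  s =i T -> k_proper_colorable e 2 2.
Proof.
move=> e_sym s_uniq s_cycle s_gt2 s_even sT.
have [x0 _] : exists x0 : T, true.
  by case: s s_gt2 {s_uniq s_cycle s_even sT} => // x0; exists x0.
exists (fun f => alt_color s x0 f : nat); split=> [u w _|].
  by case: alt_color.
apply: linked2_k_proper_connected => u w u_w.
have us : u \in s by rewrite sT.
have ws : w \in s by rewrite sT.
have [a aN u_a] := cyc_nthP x0 us; rewrite eq_sym u_a in u_w.
have [k kN ->] := cyc_nth_offset s_uniq s_gt2 aN ws u_w.
rewrite u_a; apply: (cycle_linked2 s_gt2 e_sym) => //.
- exact: cyc_nth_window.
- exact: cyc_nth_period.
- by move=> i; apply: cyc_nth_edge.
by move=> i; rewrite alt_colorE.
Qed.

(** * Odd order: an even cycle through all vertices but one *)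

Section NearHamiltonian.

Variables (T : finType) (e : rel T) (s : seq T) (v : T).
Hypotheses (e_sym : symmetric e) (e_irr : irreflexive e).
Hypotheses (s_uniq : uniq s) (s_cycle : cycle e s) (s_gt2 : 2 < size s).
Hypotheses (s_even : ~~ odd (size s)) (s_v : s =i [set~ v]).
Hypothesis deg_v : size s < 2 * degree e v.
Hypothesis head_v : {in s, forall w, ~~ e v w -> ~~ e v (head v s)}.

Let N := size s.
Let x := cyc_nth s v.
Let r i := count (fun j => e v (x j)) (iota 0 i).

(* A path from v through x i can go on down the cycle when the rank r i is
   even, and up the cycle when it is odd. *)
Let col (f : {set T}) : bool :=
  if v \in f then
    [exists i : 'I_N, (odd i (+) odd (r i)) && (f == [set v; x i])]
  else alt_color s v f.

Let x_neq_v i : x i != v.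
Proof. by have := cyc_nth_mem v s_gt2 i; rewrite s_v !inE. Qed.

Let x_v i : x i <> v. Proof. exact/eqP. Qed.

Let col_cycle i : col [set x i; x i.+1] = odd i :> nat.
Proof.
by rewrite /col !inE ![v == _]eq_sym !(negbTE (x_neq_v _)) alt_colorE.
Qed.

(** The bound [i < N] is essential: [x] is periodic but the rank is not, so the formula concerns the
    representative in the first turn. *)
Let col_spoke i : i < N -> col [set v; x i] = odd i (+) odd (r i).
Proof.
move=> iN; rewrite /col !inE eqxx /=; apply/existsP/idP=> [[j]|i_col].
  case/andP=> j_col /eqP eq_ij; suff -> : i = j by [].
  have : x i \in [set v; x j] by rewrite -eq_ij !inE eqxx orbT.
  rewrite !inE (negbTE (x_neq_v i)) /= => /eqP.
  by rewrite -[i]add0n -[j : nat]add0n => /(cyc_nth_window s_uniq s_gt2)->.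
by exists (Ordinal iN); rewrite /= i_col eqxx.
Qed.

Let rN : degree e v <= r N.
Proof.
have -> : r N = count (e v) s.
  rewrite /r -[in RHS](mkseq_nth v s) count_map; apply: eq_in_count => i.
  by rewrite mem_iota /= add0n /x /cyc_nth => iN; rewrite modn_small.
apply: leq_card_count => y; rewrite inE => vy; rewrite vy s_v !inE.
by apply: contraTneq vy => ->; rewrite e_irr.
Qed.

Let col_linked2 b q p := @spoke_linked2 T e (fun f => col f : nat) N x s_gt2 e_sym
  (@cyc_nth_window T s v s_uniq s_gt2) (cyc_nth_period v s_uniq s_gt2)
  (fun i => cyc_nth_edge v s_uniq s_gt2 i s_cycle) col_cycle v x_v b q p.

(** Restates [col_linked2] with absolute positions: the spoke at [i] is directed down to [b], the
    one at [j] up to [b + N]. *)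
Let spoke b i j : b < i -> i < j -> j < b + N ->
  e v (x i) -> e v (x j) ->
  col [set v; x i] = odd i -> col [set v; x j] = ~~ odd j ->
  linked2 e (fun f => col f : nat) v (x b).
Proof.
move=> bi ij jN vi vj col_i col_j.
have i_b : b + (i - b) = i by rewrite subnKC // ltnW.
have j_b : b + (j - b) = j by rewrite subnKC // ltnW // (ltn_trans bi).
by apply: (@col_linked2 b (i - b) (j - b)); rewrite ?i_b ?j_b ?col_i ?col_j //;
  move: bi ij jN; clear; lia.
Qed.

(* A non-neighbour x b with b > 0 forces v to have at least four neighbours,
   because x 0 is then a second non-neighbour. *)
Let linked_non_neighbour b : b < N -> ~~ e v (x b) ->
  linked2 e (fun f => col f : nat) v (x b).
Proof.
move=> bN vb.
have N_gt0 : 0 < N by apply: ltn_trans s_gt2.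
have hit j : j < degree e v -> exists i, [/\ i < N, e v (x i) & r i = j].
  by move=> /leq_trans/(_ rN)/rank_hit.
have v0 : ~~ e v (x 0).
  rewrite /x /cyc_nth mod0n nth0; apply: head_v vb; exact: cyc_nth_mem.
have pos i : e v (x i) -> 0 < i by case: i => // v0'; rewrite v0' in v0.
(* The first neighbour is directed down and the second up; both exist since [N > 2] forces degree at
   least 2. *)
have [t0 [t0N vt0 rt0]] : exists i, [/\ i < N, e v (x i) & r i = 0].
  by apply: hit; lia.
have [t1 [t1N vt1 rt1]] : exists i, [/\ i < N, e v (x i) & r i = 1].
  by apply: hit; lia.
have t01 : t0 < t1 by apply: (@rank_lt (fun j => e v (x j))); rewrite -!/(r _) rt0 rt1.
have col0 : col [set v; x t0] = odd t0 by rewrite col_spoke // rt0 addbF.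
have col1 : col [set v; x t1] = ~~ odd t1 by rewrite col_spoke // rt1 addbT.
have [b0|b_gt0] := posnP b.
  by rewrite b0; apply: (spoke (pos _ vt0) t01).
(* With two neighbours before [b], the first two are used one turn later, at [t0 + N] and [t1 + N];
   since [N] is even, their parities are unchanged. Otherwise the third and fourth neighbours lie
   beyond [b]. *)
have [r_ge2|r_lt2] := leqP 2 (r b).
  have t1b : t1 < b by apply: (@rank_lt (fun j => e v (x j))); rewrite -!/(r _) rt1.
  have xN i : x (i + N) = x i := cyc_nth_period v s_uniq s_gt2 i.
  apply: (@spoke b (t0 + N) (t1 + N)); rewrite ?xN //.
  - by move: b bN b_gt0 t1b t1N t0N {vb r_ge2}; clear; lia.
  - by move: t01; clear; lia.
  - by move: t1b; clear; lia.
  - by rewrite oddD (negbTE s_even) addbF.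
  by rewrite oddD (negbTE s_even) addbF.
have deg_ge4 : 3 < degree e v.
  have : #|[set y | e v y]| <= #|~: [set v; x 0; x b]|.
    apply/subset_leq_card/subsetP=> y; rewrite !inE => vy; rewrite !negb_or.
    by apply/andP; split; [apply/andP; split|]; apply: contraTneq vy => ->; rewrite ?e_irr.
  have x0b : x 0 != x b.
    by rewrite cyc_nth_eq // mod0n modn_small // eq_sym -lt0n.
  have card3 : #|[set v; x 0; x b]| = 3.
    rewrite -setUA cardsU1 !inE cards2 x0b ![v == _]eq_sym.
    by rewrite !(negbTE (x_neq_v _)).
  have cardT : #|T| = N.+1.
    have := cardsC1 v; rewrite -(eq_card s_v) (card_uniqP s_uniq) -/N => N_T.
    by rewrite N_T prednK //; apply/card_gt0P; exists v.
  (* The degree is at most [N - 2], and at least [(N + 2) / 2] because [N] is even; hence [N >= 6]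
     and the degree is at least 4. *)
  move: deg_v s_even; rewrite /degree -/N.
  have := cardsC [set v; x 0; x b]; rewrite card3 cardT.
  by clear; lia.
have [t2 [t2N vt2 rt2]] := hit 2 (ltnW deg_ge4).
have [t3 [t3N vt3 rt3]] := hit 3 deg_ge4.
have rank_lt' i j : r i < r j -> i < j := @rank_lt (fun j => e v (x j)) i j.
apply: (spoke (i := t2) (j := t3)) => //.
- by apply: rank_lt'; rewrite rt2.
- by apply: rank_lt'; rewrite rt2 rt3.
- exact: ltn_addl.
- by rewrite col_spoke // rt2 addbF.
by rewrite col_spoke // rt3 addbT.
Qed.

(** One path is the edge itself. The other leaves through a second neighbour, and either colour of
    that spoke allows one direction along the cycle to [x b]. *)
Let linked_neighbour b : b < N -> e v (x b) ->
  linked2 e (fun f => col f : nat) v (x b).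
Proof.
move=> bN vb.
have : [set y | e v y] :\ x b != set0.
  rewrite -card_gt0; have := cardsD1 (x b) [set y | e v y].
  by rewrite inE vb; move: deg_v s_gt2; rewrite /degree; lia.
case/set0Pn=> w; rewrite !inE => /andP[w_b vw].
have ws : w \in s by rewrite s_v !inE; apply: contraTneq vw => ->; rewrite e_irr.
have [k kN w_k] := cyc_nth_offset s_uniq s_gt2 bN ws w_b; rewrite {}w_k -/x in vw.
have vb0 : e v (x (b + 0)) by rewrite addn0.
have vbN : e v (x (b + N)) by rewrite /x cyc_nth_period.
have [ck|ck] := eqVneq (col [set v; x (b + k)]) (odd (b + k)).
  apply: (@col_linked2 b k N); rewrite ?ck ?ltnn //.
  - by case/andP: kN => _ ->; rewrite leqnn.
  by left; case/andP: kN.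
apply: (@col_linked2 b 0 k) => //.
- by case/andP: kN => -> /ltnW->.
- by right; case/andP: kN.
by move=> _; move: ck; case: odd; case: col.
Qed.

Lemma near_hamiltonian_odd : k_proper_colorable e 2 2.
Proof.
exists (fun f => col f : nat); split=> [u w _|]; first by case: col.
have linked_v w : w != v -> linked2 e (fun f => col f : nat) v w.
  move=> w_v; have ws : w \in s by rewrite s_v !inE.
  have [b bN ->] := cyc_nthP v ws.
  by have [vb|vb] := boolP (e v (x b)); [apply: linked_neighbour | apply: linked_non_neighbour].
apply: linked2_k_proper_connected => u w u_w.
have [u_v|u_v] := eqVneq u v; first by rewrite u_v; apply: linked_v; rewrite -u_v eq_sym.
have [w_v|w_v] := eqVneq w v; first by rewrite w_v; apply/linked2_sym/linked_v.
have us : u \in s by rewrite s_v !inE.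
have ws : w \in s by rewrite s_v !inE.
have [a aN u_a] := cyc_nthP v us; rewrite eq_sym u_a in u_w.
have [k kN ->] := cyc_nth_offset s_uniq s_gt2 aN ws u_w.
rewrite u_a; apply: (cycle_linked2 s_gt2 e_sym) => //.
- exact: cyc_nth_window.
- exact: cyc_nth_period.
by move=> i; apply: cyc_nth_edge.
Qed.

End NearHamiltonian.

(** * Lower bound on colours, and 2-connectedness *)

Lemma min_degree_le (T : finType) (e : rel T) x : min_degree e <= degree e x.
Proof.
rewrite /min_degree; elim: (index_enum T) (mem_index_enum x) => // y s IHs.
rewrite big_cons inE => /predU1P[->|/IHs]; first exact: geq_minl.
by apply: leq_trans; apply: geq_minr.
Qed.

(** With at most one colour a proper path has a single edge, so two distinct ones cannot join the
    same vertices. *)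
Lemma proper_colors_ge2 (T : finType) (e : rel T) m :
  1 < #|T| -> k_proper_colorable e 2 m -> 1 < m.
Proof.
move=> T_gt1 [c [c_lt conn]]; rewrite ltnNge; apply/negP=> m_le1.
have [u [w [_ _ u_w]]] := card_gt1P T_gt1.
have [P [P_inj P_path _]] := conn u w u_w.
have c0 y z : e y z -> c [set y; z] = 0.
  by move/c_lt; case: m m_le1 {c_lt} => [|[|m]] //; case: (c _).
have P1 i : P i = [:: w].
  have [[] ] := P_path i; case: (P i) => [|y [|z p]] /=.
  - by move=> _ uw; rewrite uw eqxx in u_w.
  - by move=> _ ->.
  by case/and3P=> /c0 uy /c0 yz _ _ _; rewrite /proper_path /= uy yz.
by have /P_inj : P ord0 = P ord_max by rewrite !P1.
Qed.

(** Non-adjacent vertices have degree sum at least [#|T|] with all neighbours among the other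
    [#|T| - 2] vertices, so they share two neighbours, and [S] misses one. *)
Lemma dirac_2_connected (T : finType) (e : rel T) :
  symmetric e -> irreflexive e -> 2 < #|T| ->
  (forall x, #|T| <= 2 * degree e x) -> k_connected e 2.
Proof.
move=> e_sym e_irr T_gt2 deg; split=> // S S_lt2 u w uS wS.
have [->|u_w] := eqVneq u w; first exact: connect0.
have [uw|uw] := boolP (e u w).
  by apply: connect1; rewrite /induced /= !inE uS wS.
pose Nu := [set y | e u y]; pose Nw := [set y | e w y].
have : ~~ (Nu :&: Nw \subset S).
  apply/negP=> /subset_leq_card; have := cardsU Nu Nw.
  have : Nu :|: Nw \subset ~: [set u; w].
    apply/subsetP=> y; rewrite !inE negb_or => /orP[] yN; apply/andP; split;
      apply: contraTneq yN => ->; rewrite ?e_irr // e_sym //.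
  move/subset_leq_card; have := cardsC [set u; w]; rewrite cards2 u_w.
  have := deg u; have := deg w; rewrite /degree -/Nu -/Nw.
  have := subset_leq_card (subsetIl Nu Nw).
  move: S_lt2; clear; lia.
case/subsetPn=> z; rewrite !inE => /andP[uz wz] zS.
apply: (@connect_trans _ _ z); apply: connect1; rewrite /induced /= !inE zS ?uS ?wS //.
by rewrite e_sym.
Qed.

(** * Assembly by the parity of the order *)

Theorem theorem4p2 (T : finType) (e : rel T) (n delta : nat)
  (simple_e : simple_graph e)
  (connected_e : connected_graph e)
  (card_T : #|T| = n)
  (min_degree_e : min_degree e = delta)
  (delta_ge : n <= 2 * delta)
  (n_ge4 : 4 <= n) :
  is_pc e 2 2.
Proof.
have [e_sym e_irr] := simple_e.
have deg x : #|T| <= 2 * degree e x.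
  rewrite card_T (leq_trans delta_ge) // leq_mul2l -min_degree_e.
  exact: min_degree_le.
split; last by move=> m; apply: proper_colors_ge2; rewrite card_T ltnW // ltnW.
  by apply: dirac_2_connected => //; rewrite card_T ltnW.
have [n_odd|n_even] := boolP (odd n); last first.
  have [|x _|s [s_uniq s_cycle sT]] := @dirac T e e_sym e_irr [set: T].
  - by rewrite -card_gt0 cardsT card_T; lia.
  - have -> : [set y in [set: T] | e x y] = [set y | e x y].
      by apply/setP=> y; rewrite !inE.
    by rewrite cardsT; apply: deg.
  have s_n : size s = n by rewrite -(card_uniqP s_uniq) (eq_card sT) cardsT.
  apply: (hamiltonian_even e_sym s_uniq s_cycle); rewrite ?s_n //.
    exact: ltnW.
  by move=> y; rewrite sT !inE.
have /card_gt0P[v _] : 0 < #|T| by rewrite card_T; apply: leq_trans n_ge4.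
have card_A : #|[set~ v]| = n.-1 by rewrite cardsC1 card_T.
have [|x xv|s [s_uniq s_cycle s_v]] := @dirac T e e_sym e_irr [set~ v].
- by rewrite -card_gt0 card_A; lia.
(* Deleting [v] costs at most one neighbour; for [n] odd, twice the degree is at least [n + 1],
   which leaves the required [n.-1]. *)
- rewrite card_A; have := deg x; rewrite /degree card_T (cardsD1 v).
  suff -> : [set y in [set~ v] | e x y] = [set y | e x y] :\ v.
    by case: (v \in _); lia.
  by apply/setP=> y; rewrite !inE.
have s_n : size s = n.-1 by rewrite -(card_uniqP s_uniq) (eq_card s_v).
(* The cycle is rotated to start at its first non-neighbour of [v]; if there is none, [find] returns
   the size and nothing moves. *)
pose s' := rot (find (predC (e v)) s) s.
apply: (@near_hamiltonian_odd _ _ s' v) => //.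
- by rewrite rot_uniq.
- by rewrite rot_cycle.
- by rewrite size_rot s_n; lia.
- by rewrite size_rot s_n; move: n_ge4 n_odd; clear; lia.
- by move=> y; rewrite mem_rot s_v.
- by have := deg v; rewrite size_rot s_n card_T; lia.
move=> w; rewrite mem_rot => ws vw.
have has_s : has (predC (e v)) s by apply/hasP; exists w.
have := nth_find v has_s; rewrite /s' /rot -nth0 nth_cat nth_drop addn0.
by rewrite size_drop subn_gt0 -has_find has_s.
Qed.
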